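(* Let $\beta\in\mathrm{Br}_n^+$ be a positive braid with Demazure product $\delta(\beta)=w_0$ and Coxeter projection $w=\pi(\beta)$. Let $\{1,\dots,n\}=I_1\sqcup\dots\sqcup I_k$ be a set partition into subsets stable under the action of $ww_0$, and let $T_{I_1,\dots,I_k}=\{(t_1,\dots,t_n)\in(\mathbb{C}^\times)^n:t_i=t_{i'}\text{ whenever } i,i'\text{ lie in the same } I_j\}$. For $j=1,\dots,k$ let $\beta_j$ be the braid obtained from $\beta$ by considering only the strands indexed by $I_j$. Then the set of elements of the braid variety $X(\beta)$ which are stabilized by $T_{I_1,\dots,I_k}$ is either: (1) isomorphic to $X(\beta_1)\times X(\beta_2)\times\cdots\times X(\beta_k)$, if for all $j$ the Demazure product $\delta(\beta_j)$ is the longest element of $S_{I_j}$; or (2) empty, otherwise. In particular, the intersection of the sets of points stabilized by two such subtori of $(\mathbb{C}^\times)^n$ is either empty or isomorphic to the product of braid varieties associated with the coarsest common refinement of the corresponding partitions of the set of orbits of $ww_0$.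
   Context: $\mathrm{Br}_n^+$ is the positive braid monoid on $n$ strands with generators $\sigma_1,\dots,\sigma_{n-1}$; $\pi(\sigma_{i_1}\cdots\sigma_{i_\ell})=s_{i_1}\cdots s_{i_\ell}\in S_n$ with $s_i=(i\ \,i+1)$ (products are compositions of functions); $w_0$ is the longest element of $S_n$. The Demazure product $\delta:\mathrm{Br}_n^+\to S_n$ is defined by $\delta(1)=1$ and $\delta(\beta\sigma_i)=\delta(\beta)s_i$ if $\ell(\delta(\beta)s_i)>\ell(\delta(\beta))$, and $\delta(\beta\sigma_i)=\delta(\beta)$ otherwise. Partitions into $ww_0$-stable sets are equivalent to set partitions of the set of components of the closure of $\beta\Delta^{\pm1}$, where $\Delta$ is the half-twist (minimal positive lift of $w_0$). $B_i(z)$ is the $n\times n$ identity matrix except for the block $\begin{pmatrix} z&-1\\1&0\end{pmatrix}$ in rows and columns $i,i+1$; for $\beta=\sigma_{i_1}\cdots\sigma_{i_\ell}$, $B_\beta(z)=B_{i_1}(z_1)\cdots B_{i_\ell}(z_\ell)$. The braid variety is $X(\beta)=\{(z_1,\dots,z_\ell)\in\mathbb{C}^\ell:\delta(\beta)^{-1}B_\beta(z)\text{ is upper triangular}\}$, where $\delta(\beta)$ is identified with its permutation matrix. Up to isomorphism it depends only on the braid and not on the word. Strands: draw $\beta$ from left to right on levels $1,\dots,n$, $\sigma_i$ being a crossing of the strands at levels $i$ and $i+1$; the $p$-th strand is the one at level $p$ at the left end. The torus $(\mathbb{C}^\times)^n$ acts on $X(\beta)$ by multiplying $z_k$ by $t_p/t_q$,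 where $p$ (resp. $q$) is the strand at level $i_k$ (resp. $i_k+1$) just before the $k$-th crossing. $\beta_j$ is obtained from the diagram of $\beta$ by deleting all strands not indexed by $I_j$. *)

(* Defs.v *)
From HB Require Import structures.
From mathcomp Require Import all_boot all_order all_fingroup all_algebra.
From mathcomp Require Import zify.
From mathcomp Require Import complex mpoly reals.

Set Implicit Arguments.
Unset Strict Implicit.
Unset Printing Implicit Defensive.

Import Order.TTheory GRing.Theory Num.Theory.
Local Open Scope nat_scope.

(** Strands and levels are numbered from 0: they are elements of ['I_n], and
    [i : 'I_n.-1] stands for the braid generator that crosses the adjacent
    levels [i] and [i.+1].  A positive braid is given by a word. *)

Section Permutations.
Variable n : nat.
Implicit Types (u v : 'S_n) (i : 'I_n.-1) (b : seq 'I_n.-1).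

Lemma hi_subproof i : i.+1 < n.
Proof. by have := ltn_ord i; lia. Qed.

Definition lo i : 'I_n := widen_ord (leq_pred n) i.
Definition hi i : 'I_n := Ordinal (hi_subproof i).

(** Products of permutations are read as compositions of functions, whereas the
    group law of ['S_n] applies its left factor first. *)
Definition perm_comp u v : 'S_n := (v * u)%g.

Lemma perm_compE u v x : perm_comp u v x = u (v x).
Proof. by rewrite permM. Qed.

Definition simple_refl i : 'S_n := tperm (lo i) (hi i).

Definition coxeter b : 'S_n :=
  foldr (fun i u => perm_comp (simple_refl i) u) 1%g b.

Definition inversions u : {set 'I_n * 'I_n} :=
  [set p : 'I_n * 'I_n | (p.1 < p.2) && (u p.2 < u p.1)].

Definition len u : nat := #|inversions u|.

Definition w0 : 'S_n := perm (@rev_ord_inj n).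

Definition demazure b : 'S_n :=
  foldl (fun u i => if len u < len (perm_comp u (simple_refl i))
                    then perm_comp u (simple_refl i) else u) 1%g b.

Lemma coxeter_rcons b i :
  coxeter (rcons b i) = perm_comp (coxeter b) (simple_refl i).
Proof.
elim: b => [|j b IH] /=; first by rewrite /perm_comp mulg1 mul1g.
by rewrite IH /perm_comp mulgA.
Qed.

(** The strand that is at level [x] just before the [k]-th crossing
    ([k] counted from 0) is [strand b k x]. *)
Definition strand b (k : nat) : 'S_n := coxeter (take k b).

Lemma strand0 b x : strand b 0 x = x.
Proof. by rewrite /strand take0 perm1. Qed.

Lemma strandS b (k : 'I_(size b)) x :
  strand b k.+1 x = strand b k (simple_refl (tnth (in_tuple b) k) x).
Proof.
rewrite /strand; case: b k => [|i0 b] k; first by case: k.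
by rewrite (tnth_nth i0) (take_nth i0) // coxeter_rcons perm_compE.
Qed.

End Permutations.


(** [len] is the Coxeter length, and [w0] is the unique element of maximal
    length. *)

Section Length.
Variable n : nat.
Implicit Types (u v : 'S_n) (i : 'I_n.-1) (b : seq 'I_n.-1).

Lemma simple_reflK i x : simple_refl i (simple_refl i x) = x.
Proof. by rewrite -permM tperm2 perm1. Qed.

Lemma perm_comp_reflK u i :
  perm_comp (perm_comp u (simple_refl i)) (simple_refl i) = u.
Proof. by apply/permP => x; rewrite !perm_compE simple_reflK. Qed.

Lemma simple_refl_lt i (x y : 'I_n) : x < y -> (x, y) != (lo i, hi i) ->
  simple_refl i x < simple_refl i y.
Proof.
rewrite xpair_eqE /simple_refl => ltxy neq.
case: tpermP => [ex|ex|/eqP ex1 /eqP ex2];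
  case: tpermP => [ey|ey|/eqP ey1 /eqP ey2]; subst; move: ltxy neq;
  try move: ex1; try move: ex2; try move: ey1; try move: ey2;
  rewrite -?val_eqE /=; lia.
Qed.

Lemma len_asc u i : u (lo i) < u (hi i) ->
  len (perm_comp u (simple_refl i)) = (len u).+1.
Proof.
move=> asc; pose s := simple_refl i; pose f p := (s p.1, s p.2).
have fK : involutive f by case=> x y; rewrite /f /= !simple_reflK.
have eq_inv : inversions (perm_comp u s) = (lo i, hi i) |: f @^-1: inversions u.
  apply/setP=> -[x y]; rewrite !inE /= !perm_compE.
  have [[-> ->]|neq] := eqVneq (x, y) (lo i, hi i).
    by rewrite /s tpermL tpermR /= asc ltnSn.
  have [[ex ey]|neqs] := eqVneq (s x, s y) (lo i, hi i).
    rewrite ex ey; apply/andP/andP => -[_]; lia.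
  apply/andP/andP=> -[ltxy lt_u]; split=> //; first exact: simple_refl_lt.
  by rewrite -[x](simple_reflK i) -[y](simple_reflK i); exact: simple_refl_lt.
rewrite /len eq_inv cardsU1 inE /f /= inE /= /s tpermL tpermR.
rewrite (_ : (_ < _) = false) /=; last by lia.
rewrite -(can2_imset_pre _ fK fK) card_imset //; exact: inv_inj.
Qed.

Lemma len_desc u i : u (hi i) < u (lo i) ->
  (len (perm_comp u (simple_refl i))).+1 = len u.
Proof.
move=> desc; rewrite -(@len_asc _ i) ?perm_comp_reflK //.
by rewrite !perm_compE /simple_refl tpermL tpermR.
Qed.

Lemma perm_incr_eq1 u : {homo u : x y / x < y} -> u = 1%g.
Proof.
move=> incr; apply/permP=> x; rewrite perm1; apply/val_inj => /=.
have incrE y z : (u y < u z) = (y < z).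
  by case: (ltngtP y z) => [/incr //|/incr|/val_inj ->]; lia.
have cardI (y : 'I_n) : #|[set z : 'I_n | z < y]| = y.
  have le_yn : y <= n by apply: ltnW.
  have inj : injective (widen_ord le_yn).
    by move=> a c /(congr1 val) /= /val_inj.
  rewrite -[RHS]card_ord -(card_imset _ inj).
  apply: eq_card => z; rewrite inE; apply/idP/imsetP => [lt|[t _ ->]] //=.
  by exists (Ordinal lt) => //; apply: val_inj.
rewrite -[LHS]cardI -[RHS]cardI -(card_preimset _ (@perm_inj _ u)).
by apply: eq_card => y; rewrite !inE incrE.
Qed.

Lemma exists_desc u : u != 1%g -> exists i, u (hi i) < u (lo i).
Proof.
move=> u1; apply/existsP; apply: contraNT u1 => /existsPn asc.
apply/eqP/perm_incr_eq1 => x y.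
have [d] := ubnP (y - x); elim: d => // d IH in y *; rewrite ltnS => led ltxy.
have y1 : y.-1 < n.-1 by have := ltn_ord y; lia.
have ehi : hi (Ordinal y1) = y by apply: val_inj => /=; lia.
have lt1 : u (lo (Ordinal y1)) < u y.
  have := asc (Ordinal y1); rewrite ehi -leqNgt leq_eqVlt => /orP[|//].
  by move/eqP/val_inj/perm_inj/(congr1 val) => /=; lia.
have [eqx|neq] := eqVneq x (lo (Ordinal y1)); first by rewrite eqx.
apply: ltn_trans lt1; apply: IH; move: neq; rewrite -?val_eqE /=; lia.
Qed.

Lemma len_min b : len (coxeter b) <= size b.
Proof.
elim/last_ind: b => [|b i IH].
  rewrite leqn0 cards_eq0; apply/eqP/setP=> -[x y].
  by rewrite !inE !perm1 /=; apply/negP; lia.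
rewrite coxeter_rcons size_rcons; set u := coxeter b in IH *.
case: (ltngtP (u (lo i)) (u (hi i))) => [/len_asc->|/len_desc|] //; first lia.
by move/val_inj/perm_inj/(congr1 val) => /=; lia.
Qed.

Lemma len_attained u : exists2 b, coxeter b = u & size b = len u.
Proof.
have [m] := ubnP (len u); elim: m => // m IH in u *; rewrite ltnS => lem.
have [->|/exists_desc[i desc]] := eqVneq u 1%g.
  by exists [::] => //; apply/esym/eqP; rewrite -leqn0 (len_min [::]).
have lenS := len_desc desc.
have [|b eb sb] := IH (perm_comp u (simple_refl i)); first lia.
exists (rcons b i); last by rewrite size_rcons sb.
by rewrite coxeter_rcons eb perm_comp_reflK.
Qed.

Lemma inversions_w0 : inversions (w0 n) = [set p : 'I_n * 'I_n | p.1 < p.2].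
Proof.
apply/setP=> -[x y]; rewrite !inE !permE /=.
by have := ltn_ord x; have := ltn_ord y; lia.
Qed.

Lemma w0_longest u : len u <= len (w0 n) ?= iff (u == w0 n).
Proof.
have sub : inversions u \subset inversions (w0 n).
  by apply/subsetP => p; rewrite inversions_w0 !inE => /andP[].
split; first exact: subset_leq_card.
apply/eqP/eqP => [eq_len|->] //.
have eqI : inversions u = inversions (w0 n).
  by apply/eqP; rewrite eqEcard sub -/(len u) eq_len leqnn.
have w0K x : w0 n (w0 n x) = x by rewrite !permE rev_ordK.
suff uw0 : perm_comp u (w0 n) = 1%g.
  by apply/permP => x; rewrite -[x in LHS]w0K -perm_compE uw0 perm1.
apply: perm_incr_eq1 => x y ltxy; rewrite !perm_compE.
have : (w0 n y, w0 n x) \in inversions u.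
  by rewrite eqI inE /= !w0K ltxy !permE /=; have := ltn_ord y; lia.
by rewrite inE => /andP[].
Qed.

End Length.

(** Deletion of the strands outside [I]: the crossing [i], met when the strands
    are placed according to [u], survives if both of its strands are in [I]; its
    new level is then the number of remaining strands below it. *)

Section Subbraid.
Variables (n : nat) (I : {set 'I_n}).
Implicit Types (u : 'S_n) (i : 'I_n.-1) (b : seq 'I_n.-1).

Definition subbraid_letter u i : option 'I_#|I|.-1 :=
  if (u (lo i) \in I) && (u (hi i) \in I)
  then insub #|[set x : 'I_n | (x < lo i) && (u x \in I)]|
  else None.

Lemma subbraid_letter_val u i : u (lo i) \in I -> u (hi i) \in I ->
  omap val (subbraid_letter u i) =
    Some #|[set x : 'I_n | (x < lo i) && (u x \in I)]|.
Proof.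
move=> Ilo Ihi; rewrite /subbraid_letter Ilo Ihi /=; set A := [set x | _].
suff lt : #|A| < #|I|.-1 by rewrite insubT.
have : lo i |: (hi i |: A) \subset u @^-1: I.
  by apply/subsetP=> x; rewrite !inE => /or3P[/eqP->|/eqP->|/andP[]].
move/subset_leq_card; rewrite (card_preimset _ (@perm_inj _ u)).
rewrite !cardsU1 !inE -val_eqE /= ltnn /=.
have -> : (i.+1 < i) = false by lia.
have -> : (i == i.+1 :> nat) = false by lia.
by rewrite /=; lia.
Qed.

Definition subbraid b : seq 'I_#|I|.-1 :=
  pmap (fun k : 'I_(size b) =>
          subbraid_letter (strand b k) (tnth (in_tuple b) k))
       (enum 'I_(size b)).

End Subbraid.

Section Varieties.
Local Open Scope ring_scope.
Variable K : fieldType.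

(** Affine algebraic sets are subsets of the affine spaces ['rV[K]_m], and
    morphisms between them are restrictions of polynomial maps.*)

Definition poly_eval m p (f : 'I_p -> {mpoly K[m]}) (x : 'rV[K]_m) : 'rV[K]_p :=
  \row_j (f j).@[fun i => x 0 i].

Definition isomorphic m p
    (X : 'rV[K]_m -> Prop) (Y : 'rV[K]_p -> Prop) : Prop :=
  exists (f : 'I_p -> {mpoly K[m]}) (g : 'I_m -> {mpoly K[p]}),
    (forall x, X x -> Y (poly_eval f x) /\ poly_eval g (poly_eval f x) = x) /\
    (forall y, Y y -> X (poly_eval g y) /\ poly_eval f (poly_eval g y) = y).

Section BraidVariety.
Variable n : nat.
Implicit Types (b : seq 'I_n.-1) (t : 'I_n -> K) (P : {set {set 'I_n}}).

Definition letter_mx (i : 'I_n.-1) (z : K) : 'M[K]_n :=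
  \matrix_(p, q)
    if (p == lo i) && (q == lo i) then z
    else if (p == lo i) && (q == hi i) then -1
    else if (p == hi i) && (q == lo i) then 1
    else if (p == hi i) && (q == hi i) then 0
    else (p == q)%:R.

Definition braid_mx b (z : 'rV[K]_(size b)) : 'M[K]_n :=
  \prod_(k < size b) letter_mx (tnth (in_tuple b) k) (z 0 k).

(** The matrix that maps the basis vector [e_q] to [e_(u q)]; the library's
    [perm_mx u] is its transpose. *)
Definition permutation_mx (u : 'S_n) : 'M[K]_n := \matrix_(p, q) (p == u q)%:R.

(** [is_trig_mx] means lower triangular. *)
Definition upper_triangular (A : 'M[K]_n) : bool := is_trig_mx A^T.

Definition braid_variety b (z : 'rV[K]_(size b)) : Prop :=
  upper_triangular (invmx (permutation_mx (demazure b)) *m braid_mx z).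

Definition torus_act b t (z : 'rV[K]_(size b)) : 'rV[K]_(size b) :=
  \row_k (t (strand b k (lo (tnth (in_tuple b) k))) /
          t (strand b k (hi (tnth (in_tuple b) k))) * z 0 k).

Definition subtorus P t : Prop :=
  (forall i, t i != 0) /\
  (forall I, I \in P -> {in I &, forall i i', t i = t i'}).

Definition fixed_points b P (z : 'rV[K]_(size b)) : Prop :=
  braid_variety z /\ forall t, subtorus P t -> torus_act t z = z.

End BraidVariety.

(** The product of the braid varieties of the [subbraid I b], for [I] a block
    of [P], in the product of their ambient affine spaces. *)
Definition product_variety n (b : seq 'I_n.-1) (P : {set {set 'I_n}})
    (v : 'rV[K]_(\sum_(j < #|P|) size (subbraid (enum_val j) b))) : Prop :=
  forall j : 'I_#|P|, braid_variety (submxrow v j).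

End Varieties.

Arguments braid_variety K {n} b z.
Arguments fixed_points K {n} b P z.
Arguments product_variety K {n} b P v.

Section Partitions.
Variables (n : nat) (u : 'S_n).
Implicit Types P Q S : {set {set 'I_n}}.

(** Set partitions of the strands into [u]-stable blocks, that is, partitions of
    the set of orbits of [u]. *)
Definition stable_partition P : Prop :=
  partition P [set: 'I_n] /\ forall I, I \in P -> u @: I = I.

Definition refines S P : Prop :=
  forall A, A \in S -> exists2 B, B \in P & A \subset B.

Definition coarsest_common_refinement P Q S : Prop :=
  [/\ stable_partition S, refines S P, refines S Q &
      forall S', stable_partition S' -> refines S' P -> refines S' Q ->
        refines S' S].

Lemma coarsest_common_refinement_exists P Q :
  stable_partition P -> stable_partition Q ->
  coarsest_common_refinement P Q ([set A :&: B | A in P, B in Q] :\ set0).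
Proof.
move=> [/and3P[/eqP covP trP P0] stP] [/and3P[/eqP covQ trQ Q0] stQ].
split=> [|A|A|S' [/and3P[_ _ S0] _] refP refQ A SA].
- split; last first.
    move=> I; rewrite !inE => /andP[_ /imset2P[A B PA QB ->]].
    by rewrite imsetI ?(stP A PA) ?(stQ B QB) // => x y _ _; apply: perm_inj.
  apply/and3P; split; last by rewrite !inE eqxx.
  + rewrite eqEsubset subsetT; apply/subsetP => x _.
    have /bigcupP[A PA xA] : x \in cover P by rewrite covP.
    have /bigcupP[B QB xB] : x \in cover Q by rewrite covQ.
    have xAB : x \in A :&: B by rewrite inE xA.
    apply/bigcupP; exists (A :&: B) => //; rewrite !inE imset2_f // andbT.
    by apply/set0Pn; exists x.
  + apply/trivIsetP => C D; rewrite !inE => /andP[_ /imset2P[A B PA QB ->]].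
    move=> /andP[_ /imset2P[A' B' PA' QB' ->]]; apply: contraNT.
    case/pred0Pn => x /andP[/= /setIP[xA xB] /setIP[xA' xB']].
    rewrite -(def_pblock trP PA xA) (def_pblock trP PA' xA').
    by rewrite -(def_pblock trQ QB xB) (def_pblock trQ QB' xB').
- rewrite !inE => /andP[_ /imset2P[B C PB QC ->]].
  by exists B => //; apply: subsetIl.
- rewrite !inE => /andP[_ /imset2P[B C PB QC ->]].
  by exists C => //; apply: subsetIr.
have [B PB AB] := refP A SA; have [C QC AC] := refQ A SA.
have sAI : A \subset B :&: C by rewrite subsetI AB.
exists (B :&: C) => //; rewrite !inE imset2_f // andbT.
apply: contraNneq S0 => BC0; suff <- : A = set0 by [].
by apply/eqP; rewrite -subset0 -BC0.
Qed.

End Partitions.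

(* Main.v *)
(** A point of [X(beta)] is fixed by the subtorus iff [z_k = 0] whenever the
    strands of the [k]-th crossing lie in different blocks; such a crossing
    contributes the signed transposition [0 -1; 1 0].  The rows of [B_beta(z)]
    indexed by [I], restricted to the columns where the strands of [I] end,
    therefore form the braid matrix of the subbraid of [I], once the signs are
    absorbed into the surviving coordinates, and [B_beta(z)] vanishes outside
    these minors.  As [w w0] preserves [I], those columns are the levels
    [w0 (I)], so that [B_beta(z)] vanishes above the antidiagonal iff each of
    the minors does.

    A block with [delta(beta_I) <> w0] leaves no point: the rank of every lower
    left corner of [B_beta(z)] is at most that of the permutation matrix of
    [delta(beta)], and an invertible matrix that vanishes above its antidiagonal
    has the corner ranks of [w0]. *)

Require Import Defs.
From mathcomp Require Import all_boot all_order all_fingroup all_algebra.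
From mathcomp Require Import complex mpoly reals.
From mathcomp Require Import zify.

Set Implicit Arguments.
Unset Strict Implicit.
Unset Printing Implicit Defensive.

Import GRing.Theory.

Lemma index_enumE (T : finType) : index_enum T = enum T.
Proof. by rewrite [index_enum T]unlock -enumT. Qed.

(** * Letter matrices: action on rows and columns, and invertibility *)

Section LetterMatrices.
Local Open Scope ring_scope.
Variables (K : fieldType) (n : nat).
Implicit Types (b : seq 'I_n.-1) (i : 'I_n.-1) (z : K).

Lemma lo_neq_hi i : (lo i == hi i) = false.
Proof. by rewrite -val_eqE /=; lia. Qed.

Lemma mulmx_letterE m (M : 'M[K]_(m, n)) i z r x :
  (M *m letter_mx i z) r x =
    if x == lo i then z * M r (lo i) + M r (hi i)
    else if x == hi i then - M r (lo i) else M r x.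
Proof.
have lh := lo_neq_hi i; have hl : (hi i == lo i) = false by rewrite eq_sym.
rewrite mxE; case: (eqVneq x (lo i)) => [->|xlo].
  rewrite (bigD1 (lo i)) //= (bigD1 (hi i)) ?hl //= !mxE !eqxx lh hl /=.
  rewrite mulr1 mulrC addrA big1 ?addr0 // => y /andP[ylo yhi].
  by rewrite mxE (negPf ylo) (negPf yhi) mulr0.
case: (eqVneq x (hi i)) => [->|xhi].
  rewrite (bigD1 (lo i)) //= (bigD1 (hi i)) ?hl //= !mxE !eqxx hl /=.
  rewrite mulr0 add0r mulrN1 big1 ?addr0 // => y /andP[ylo yhi].
  by rewrite mxE (negPf ylo) (negPf yhi) mulr0.
rewrite (bigD1 x) //= mxE eqxx (negPf xlo) (negPf xhi) mulr1.
rewrite big1 ?addr0 // => y yx.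
by rewrite mxE (negPf yx) (negPf xlo) (negPf xhi) !andbF mulr0.
Qed.

Lemma letter_mulmxE m (M : 'M[K]_(n, m)) i z r x :
  (letter_mx i z *m M) r x =
    if r == lo i then z * M (lo i) x - M (hi i) x
    else if r == hi i then M (lo i) x else M r x.
Proof.
have lh := lo_neq_hi i; have hl : (hi i == lo i) = false by rewrite eq_sym.
rewrite mxE; case: (eqVneq r (lo i)) => [->|rlo].
  rewrite (bigD1 (lo i)) //= (bigD1 (hi i)) ?hl //= !mxE !eqxx lh hl /=.
  rewrite mulN1r addrA big1 ?addr0 // => y /andP[ylo yhi].
  by rewrite mxE !eqxx lh (negPf ylo) (negPf yhi) eq_sym (negPf ylo) mul0r.
case: (eqVneq r (hi i)) => [->|rhi].
  rewrite (bigD1 (lo i)) //= (bigD1 (hi i)) ?hl //= !mxE !eqxx hl /=.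
  rewrite mul1r mul0r add0r big1 ?addr0 // => y /andP[ylo yhi].
  by rewrite mxE !eqxx hl (negPf ylo) (negPf yhi) eq_sym (negPf yhi) mul0r.
rewrite (bigD1 r) //= mxE eqxx (negPf rlo) (negPf rhi) mul1r.
rewrite big1 ?addr0 // => y yr.
by rewrite mxE (negPf rlo) (negPf rhi) /= eq_sym (negPf yr) mul0r.
Qed.

Lemma letter_mx_unit i z : letter_mx i z \in unitmx.
Proof.
rewrite -row_free_unit; apply: inj_row_free => v v0.
have colE x : (v *m letter_mx i z) 0 x = 0 by rewrite v0 mxE.
have vlo : v 0 (lo i) = 0.
  by have /eqP := colE (hi i); rewrite mulmx_letterE [hi i == _]eq_sym lo_neq_hi eqxx oppr_eq0 => /eqP.
apply/rowP => x; rewrite [RHS]mxE; have := colE x; rewrite mulmx_letterE.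
case: eqVneq => [-> _ //|_]; case: eqVneq => [-> _|//].
by have := colE (lo i); rewrite mulmx_letterE eqxx vlo mulr0 add0r.
Qed.

Lemma braid_mx_unit b (z : 'rV[K]_(size b)) : braid_mx z \in unitmx.
Proof.
rewrite /braid_mx; elim/big_ind: _ => [|A B uA uB|k _]; first exact: unitmx1.
- by rewrite unitmx_mul uA.
- exact: letter_mx_unit.
Qed.

End LetterMatrices.

(** * Corner ranks and the Demazure product *)

Section Corners.
Local Open Scope ring_scope.
Variables (K : fieldType) (n : nat).
Implicit Types (b : seq 'I_n.-1) (M : 'M[K]_n) (p c : nat) (u : 'S_n) (i : 'I_n.-1).

(** The lower left block is padded with zeros to full size: its rank is unchanged, and letters can
    act on it by right multiplication. *)
Definition corner p c M : 'M[K]_n :=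
  \matrix_(a, x) if (p <= a)%N && (x < c)%N then M a x else 0.

(** This is the rank of the same corner of [permutation_mx u], whose column [x] has its 1 in row
    [u x]. *)
Definition perm_corner p c u : nat := #|[set x : 'I_n | (x < c)%N && (p <= u x)%N]|.

Lemma mulmx_pid_mxE m (M : 'M[K]_(m, n)) c r x :
  (M *m (pid_mx c : 'M[K]_n)) r x = if (x < c)%N then M r x else 0.
Proof.
rewrite mxE (bigD1 x) //= mxE eqxx /= big1 ?addr0 => [|y yx].
  by case: ifP; rewrite ?mulr1 ?mulr0.
by rewrite mxE (val_eqE y x) (negPf yx) mulr0.
Qed.

(** Dropping column [c] is right multiplication by [pid_mx c]; putting it back adds a matrix of rank
    at most one. *)
Lemma rank_cornerS p c M :
  (\rank (corner p c M) <= \rank (corner p c.+1 M) <= (\rank (corner p c M)).+1)%N.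
Proof.
apply/andP; split.
  suff -> : corner p c M = corner p c.+1 M *m (pid_mx c : 'M_n) by exact: mxrankM_maxl.
  apply/matrixP => a x; rewrite mulmx_pid_mxE !mxE.
  by case: ltnP => [lt|]; rewrite ?andbF // ltnS (ltnW lt).
case: (ltnP c n) => [ltcn|lenc]; last first.
  suff -> : corner p c.+1 M = corner p c M by rewrite leqnSn.
  apply/matrixP => a x; rewrite !mxE ltnS.
  by rewrite (leq_trans (ltn_ord x) lenc) (ltnW (leq_trans (ltn_ord x) lenc)).
pose y := Ordinal ltcn.
have -> : corner p c.+1 M =
    corner p c M + col y (corner p c.+1 M) *m delta_mx (0 : 'I_1) y.
  apply/matrixP => a x; rewrite !mxE big_ord1 !mxE eqxx /= ltnS -val_eqE /=.
  case: (ltngtP x c) => // e; rewrite ?andbF ?mulr0 ?addr0 //= ltnSn andbT ?add0r mulr1.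
  by rewrite (_ : x = y) //; apply: val_inj.
apply: leq_trans (mxrank_add _ _) _; rewrite -[leqRHS]addn1 leq_add2l.
by apply: leq_trans (mxrankM_maxl _ _) _; apply: rank_leq_col.
Qed.

(* For [c != hi i], right multiplication by the letter preserves the span of the
   first [c] columns. *)
Lemma rank_corner_letter p c M i z : c != hi i :> nat ->
  (\rank (corner p c (M *m letter_mx i z)) <= \rank (corner p c M))%N.
Proof.
move=> neq; have -> : corner p c (M *m letter_mx i z) = corner p c M *m letter_mx i z.
  have hl : (hi i < c)%N = (lo i < c)%N by move: neq => /=; lia.
  apply/matrixP => a x; rewrite mxE !mulmx_letterE !mxE.
  case: eqVneq => [->|_]; rewrite ?hl; first by case: ifP; rewrite ?mulr0 ?addr0.
  by case: eqVneq => [->|//]; rewrite hl; case: ifP; rewrite ?oppr0.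
exact: mxrankM_maxl.
Qed.

Lemma perm_cornerS p (x : 'I_n) u :
  perm_corner p x.+1 u = (perm_corner p x u + (p <= u x))%N.
Proof.
rewrite /perm_corner; have := cardsD1 x [set y : 'I_n | (y < x.+1)%N && (p <= u y)%N].
rewrite inE ltnSn addnC => ->; congr (_ + _)%N; apply: eq_card => y.
by rewrite !inE -val_eqE ltnS /= [in RHS]ltn_neqAle andbA.
Qed.

(** Unless [c] separates the levels [lo i] and [hi i], the reflection permutes the levels below
    [c]. *)
Lemma perm_corner_refl p c u i : c != hi i :> nat ->
  perm_corner p c (perm_comp u (simple_refl i)) = perm_corner p c u.
Proof.
move=> neq; rewrite /perm_corner -[RHS](card_preimset _ (@perm_inj _ (simple_refl i))).
apply: eq_card => x; rewrite !inE perm_compE; congr (_ && _).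
by rewrite /simple_refl; case: tpermP => [->|->|] //; move: neq => /=; lia.
Qed.

Definition demazure_step u i : 'S_n :=
  if (len u < len (perm_comp u (simple_refl i)))%N
  then perm_comp u (simple_refl i) else u.

Lemma demazure_stepE u i :
  demazure_step u i =
    if (u (lo i) < u (hi i))%N then perm_comp u (simple_refl i) else u.
Proof.
rewrite /demazure_step; case: (ltngtP (u (lo i)) (u (hi i))) => [lt|gt|/val_inj/perm_inj].
- by rewrite len_asc ?ltnSn.
- by rewrite -(len_desc gt) ltnNge leqnSn.
- by move/eqP; rewrite lo_neq_hi.
Qed.

(** Only [c = hi i] is delicate. There the rank exceeds that of the corner at [lo i] by at most one
    and is bounded by that of the corner at [(hi i).+1], and the letter increases neither of these.
    With [q = perm_corner p (lo i) u], the smaller bound is [q], plus one if [u (lo i)] or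
    [u (hi i)] is at least [p]. The Demazure step puts the larger of the two values at [lo i], so
    this is exactly its corner count. *)
Lemma rank_corner_demazure_step M u i z :
  (forall p c, \rank (corner p c M) <= perm_corner p c u)%N ->
  forall p c,
    (\rank (corner p c (M *m letter_mx i z)) <= perm_corner p c (demazure_step u i))%N.
Proof.
move=> bnd p c; have [ec|neq] := eqVneq c (hi i); last first.
  apply: leq_trans (rank_corner_letter _ _ _ neq) _.
  by rewrite demazure_stepE; case: ifP => _; rewrite ?perm_corner_refl.
have hiS v : perm_corner p (hi i) v = (perm_corner p (lo i) v + (p <= v (lo i)))%N.
  exact: (perm_cornerS p (lo i) v).
rewrite {c}ec; set M' := M *m _.
have low : (\rank (corner p (hi i) M') <= (perm_corner p (lo i) u).+1)%N.
  have /andP[_ /leq_trans] := rank_cornerS p (lo i) M'; apply.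
  rewrite ltnS; apply: leq_trans (bnd _ _).
  by apply: rank_corner_letter; rewrite /=; lia.
have high : (\rank (corner p (hi i) M') <= perm_corner p (hi i).+1 u)%N.
  have /andP[/leq_trans + _] := rank_cornerS p (hi i) M'; apply.
  apply: leq_trans (bnd _ _).
  by apply: rank_corner_letter; rewrite /=; lia.
move: low high; rewrite perm_cornerS !hiS demazure_stepE; case: ifP => lt.
  rewrite perm_corner_refl /= ?perm_compE /simple_refl ?tpermL; last lia.
all: move: (\rank _) (perm_corner p (lo i) u) => r q;
  by case: (leqP p (u (lo i))); case: (leqP p (u (hi i))); lia.
Qed.

Lemma rank_corner1 p c : (\rank (corner p c 1%:M) <= perm_corner p c 1%g)%N.
Proof.
elim: c => [|c IH].
  by rewrite (_ : corner p 0 _ = 0) ?mxrank0 //; apply/matrixP => a x; rewrite !mxE andbF.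
case: (ltnP c n) => [ltcn|lenc]; last first.
  rewrite (_ : corner p c.+1 1%:M = corner p c 1%:M).
    apply: leq_trans IH _; apply: subset_leq_card; apply/subsetP => x.
    by rewrite !inE => /andP[/ltnW lt ->]; rewrite ltnS lt.
  apply/matrixP => a x; rewrite !mxE.
  by rewrite ltnS (ltnW (leq_trans (ltn_ord x) lenc)) (leq_trans (ltn_ord x) lenc).
rewrite (perm_cornerS p (Ordinal ltcn)) perm1 /=.
case: (leqP p c) => [lepc|ltcp].
  by have /andP[_] := rank_cornerS p c 1%:M => /leq_trans; apply; rewrite addn1 ltnS.
rewrite addn0 (_ : corner p c.+1 1%:M = corner p c 1%:M) //.
apply/matrixP => a x; rewrite !mxE ltnS -val_eqE /=.
case: (ltngtP x c) => // ->; rewrite andbT andbF; case: ifP => // lepa.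
by rewrite (_ : (a == c :> nat) = false) //; lia.
Qed.

Lemma rank_corner_braid b (z : 'rV[K]_(size b)) p c :
  (\rank (corner p c (braid_mx z)) <= perm_corner p c (demazure b))%N.
Proof.
(* The type of [z] depends on [b]; a list of pairs letter-coordinate allows induction on the last
   letter. *)
pose s := [seq (tnth (in_tuple b) k, z 0 k) | k <- enum 'I_(size b)].
have -> : braid_mx z = \prod_(x <- s) letter_mx x.1 x.2.
  by rewrite /braid_mx [RHS]big_map index_enumE.
have eb : b = map fst s by rewrite -map_comp (map_tnth_enum (in_tuple b)).
rewrite [in demazure b]eb; move: s {eb} => s; elim/last_ind: s p c => [|s x IH] p c.
  by rewrite big_nil; apply: rank_corner1.
rewrite -cats1 big_cat big_seq1 map_cat /demazure foldl_cat /=.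
exact: rank_corner_demazure_step.
Qed.

Definition anti_triangular M : Prop :=
  forall p q : 'I_n, (p + q < n.-1)%N -> M p q = 0.

Lemma anti_triangular_demazure b (z : 'rV[K]_(size b)) :
  anti_triangular (braid_mx z) -> demazure b = w0 n.
Proof.
move=> tri; have ge (q : 'I_n) : (w0 n q <= demazure b q)%N.
  have lt : (q < n)%N by [].
  have := rank_corner_braid z (w0 n q) q.+1.
  (* In the first [q.+1] columns every entry above row [w0 n q] vanishes, so the corner carries
     these whole columns of an invertible matrix and has rank [q.+1]. *)
  have -> : corner (w0 n q) q.+1 (braid_mx z) = braid_mx z *m (pid_mx q.+1 : 'M_n).
    apply/matrixP => a x; rewrite mulmx_pid_mxE mxE permE /=.
    case: ltnP => //= ltxq; rewrite ?andbF // andbT; case: leqP => // lta.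
    by rewrite tri //; lia.
  rewrite eqmxMfull ?row_full_unit ?braid_mx_unit // rank_pid_mx // perm_cornerS.
  have : (perm_corner (w0 n q) q (demazure b) <= q)%N.
    rewrite -[leqRHS]muln1.
    have -> : (q * 1 = #|[set widen_ord (ltnW lt) x | x : 'I_q]|)%N.
      rewrite muln1 card_imset ?card_ord // => x y /(congr1 val) /= /val_inj //.
    apply: subset_leq_card; apply/subsetP => x; rewrite inE => /andP[ltx _].
    by apply/imsetP; exists (Ordinal ltx) => //; apply: val_inj.
  by case: leqP => //; lia.
apply/permP => x; apply: val_inj => /=.
(* All permutations have the same sum of values, so a pointwise inequality between two of them is an
   equality. *)
have sumE (u : 'S_n) : (\sum_y u y = \sum_(y < n) y)%N.
  by rewrite [RHS](reindex_inj (@perm_inj _ u)).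
have [_] : (\sum_y w0 n y <= \sum_y demazure b y
             ?= iff [forall (y | true), w0 n y == demazure b y :> nat])%N.
  by apply: leqif_sum => y _; split.
by rewrite !sumE eqxx => /esym/forallP/(_ x)/eqP.
Qed.

End Corners.

(** * Restriction to a block of strands *)

Section RelativeLevels.
Variables (n : nat) (I : {set 'I_n}).
Implicit Types (u : 'S_n) (i : 'I_n.-1) (x y : 'I_n).

(** For [u x] in [I], this is the level of that strand after deletion of the strands outside [I],
    the number used in [subbraid_letter]. *)
Definition rel_level u x : nat := #|[set y : 'I_n | (y < x) && (u y \in I)]|.

Lemma rel_level_lt u x y : u x \in I -> x < y -> rel_level u x < rel_level u y.
Proof.
move=> ux ltxy; apply: proper_card; apply/properP; split.
  by apply/subsetP => t; rewrite !inE => /andP[/ltn_trans->].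
by exists x; rewrite inE ?ltxy // ltnn.
Qed.

Lemma rel_level_inj u : {in [pred x | u x \in I] &, injective (rel_level u)}.
Proof.
move=> x y ux uy eq; case: (ltngtP x y) => [lt|lt|/val_inj //].
  by have := rel_level_lt ux lt; rewrite eq ltnn.
by have := rel_level_lt uy lt; rewrite eq ltnn.
Qed.

Lemma rel_level_bound u x : u x \in I -> rel_level u x < #|I|.
Proof.
move=> ux; rewrite -(card_preimset I (@perm_inj _ u)); apply: proper_card.
apply/properP; split; first by apply/subsetP => t; rewrite !inE => /andP[].
by exists x; rewrite !inE ?ltnn.
Qed.

Lemma rel_level_surj u (r : 'I_#|I|) : exists2 x, u x \in I & rel_level u x = r.
Proof.
(* On [J] the default [r] is never reached, by [rel_level_bound]; surjectivity then follows from
   injectivity by counting. *)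
pose f x := insubd r (rel_level u x); pose J := u @^-1: I.
have fE x : x \in J -> f x = rel_level u x :> nat.
  by rewrite inE => ux; rewrite val_insubd rel_level_bound.
have finj : {in J &, injective f}.
  move=> x y Jx Jy /(congr1 (@nat_of_ord _)); rewrite !fE // => /rel_level_inj.
  by apply; move: Jx Jy; rewrite !inE.
have : r \in f @: J.
  suff -> : f @: J = setT by [].
  apply/eqP; rewrite eqEcard subsetT cardsT card_ord card_in_imset //.
  by rewrite card_preimset ?leqnn //; apply: perm_inj.
by case/imsetP => x Jx ->; exists x; [rewrite inE in Jx|rewrite fE].
Qed.

Lemma rel_level_refl u i x : x != hi i ->
  rel_level (perm_comp u (simple_refl i)) x = rel_level u x.
Proof.
move=> xhi; rewrite /rel_level -[RHS](card_preimset _ (@perm_inj _ (simple_refl i))).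
apply: eq_card => y; rewrite !inE perm_compE; congr (_ && _).
rewrite /simple_refl; case: tpermP => [->|->|] //; move: xhi; rewrite -val_eqE /=; lia.
Qed.

Lemma rel_level_hi u i : rel_level u (hi i) = rel_level u (lo i) + (u (lo i) \in I).
Proof.
rewrite /rel_level; have := cardsD1 (lo i) [set y : 'I_n | (y < hi i) && (u y \in I)].
rewrite inE /= ltnSn addnC => ->; congr (_ + _); apply: eq_card => y.
by rewrite !inE -val_eqE /= ltnS [in RHS]ltn_neqAle andbA.
Qed.

Lemma rel_level_refl_hi u i :
  rel_level (perm_comp u (simple_refl i)) (hi i) = rel_level u (lo i) + (u (hi i) \in I).
Proof.
rewrite rel_level_hi rel_level_refl; last by rewrite eq_sym eq_sym lo_neq_hi.
by rewrite perm_compE /simple_refl tpermL.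
Qed.

End RelativeLevels.

Section Restriction.
Local Open Scope ring_scope.
Variables (K : fieldType) (n : nat) (I : {set 'I_n}).
Implicit Types (u : 'S_n) (i : 'I_n.-1) (z : K) (e : 'I_n -> K).

(** Selects the levels occupied, in the arrangement [u], by the strands of [I],
    with a scalar [e p] attached to the strand [p]. *)
Definition select_mx u e : 'M[K]_(#|I|, n) :=
  \matrix_(r, x) if (u x \in I) && (rel_level I u x == r) then e (u x) else 0.

Lemma select_mx_refl u e i r x : x != lo i -> x != hi i ->
  select_mx (perm_comp u (simple_refl i)) e r x = select_mx u e r x.
Proof.
by move=> xlo xhi; rewrite !mxE rel_level_refl // perm_compE /simple_refl tpermD // eq_sym.
Qed.

Lemma select_mx_refl_lo u e i r :
  select_mx (perm_comp u (simple_refl i)) e r (lo i) =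
    if (u (hi i) \in I) && (rel_level I u (lo i) == r) then e (u (hi i)) else 0.
Proof. by rewrite mxE rel_level_refl ?lo_neq_hi // perm_compE /simple_refl tpermL. Qed.

Lemma select_mx_refl_hi u e i r :
  select_mx (perm_comp u (simple_refl i)) e r (hi i) =
    if (u (lo i) \in I) && ((rel_level I u (lo i) + (u (hi i) \in I))%N == r)
    then e (u (lo i)) else 0.
Proof. by rewrite mxE rel_level_refl_hi perm_compE /simple_refl tpermR. Qed.

(** The crossing survives as the letter [j]. After it, the lower level holds the strand with scalar
    [e (u (hi i))]; the entry there is [e (u (lo i)) * z], which forces the rescaling of the
    coordinate. The entries 1 and -1 match without correction. *)
Lemma select_mx_letter_in u e i z (j : 'I_#|I|.-1) :
  u (lo i) \in I -> u (hi i) \in I -> j = rel_level I u (lo i) :> nat ->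
  e (u (hi i)) != 0 ->
  select_mx u e *m letter_mx i z =
    letter_mx j (e (u (lo i)) / e (u (hi i)) * z) *m
      select_mx (perm_comp u (simple_refl i)) e.
Proof.
move=> Ilo Ihi ej e0; apply/matrixP => r x.
have lvl_hi : rel_level I u (hi i) = j.+1 by rewrite rel_level_hi Ilo ej addn1.
have rlo : (r == lo j) = (j == r :> nat) by rewrite -val_eqE eq_sym.
have rhi : (r == hi j) = (j.+1 == r) by rewrite -val_eqE eq_sym.
rewrite mulmx_letterE letter_mulmxE rlo rhi; have [->|xlo] := eqVneq x (lo i).
  rewrite !select_mx_refl_lo Ihi -ej /= eqxx (ltn_eqF (ltnSn j)) !mxE Ilo Ihi lvl_hi -ej /=.
  case: eqP => [<-|_]; last by rewrite mulr0 add0r; case: eqP.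
  by rewrite (gtn_eqF (ltnSn j)) addr0 subr0 mulrAC divfK // mulrC.
have [->|xhi] := eqVneq x (hi i).
  rewrite !select_mx_refl_hi Ilo Ihi -ej /= addn1 eqxx (gtn_eqF (ltnSn j)) !mxE Ilo -ej /=.
  case: eqP => [_|_]; first by rewrite mulr0 add0r.
  by rewrite oppr0; case: eqP.
rewrite !select_mx_refl // !mxE.
case ux: (u x \in I); last by rewrite /= mulr0 subr0 !if_same.
have lvl_neq (y : 'I_n) : x != y -> u y \in I -> (rel_level I u x == rel_level I u y) = false.
  by move=> xy uy; apply: contraNF xy => /eqP/rel_level_inj->.
have nlo : (rel_level I u x == j :> nat) = false by rewrite ej lvl_neq.
have nhi : (rel_level I u x == j.+1) = false by rewrite -lvl_hi lvl_neq.
rewrite /= nlo nhi mulr0 subr0.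
case: (eqVneq (j : nat) r) => [<-|_]; first by rewrite nlo.
by case: (eqVneq j.+1 r) => [<-|//]; rewrite nhi.
Qed.

(** If one strand is in [I], then [z = 0] and the letter moves its column to the adjacent level,
    with a sign -1 when it comes from below; [e'] records this sign. If neither is in [I], both
    columns involved are zero. *)
Lemma select_mx_letter_out u e e' i z :
  ~~ ((u (lo i) \in I) && (u (hi i) \in I)) ->
  ((u (lo i) \in I) != (u (hi i) \in I) -> z = 0) ->
  (u (lo i) \in I -> e' (u (lo i)) = - e (u (lo i))) ->
  {in I, forall p, p != u (lo i) -> e' p = e p} ->
  select_mx u e *m letter_mx i z = select_mx (perm_comp u (simple_refl i)) e'.
Proof.
move=> out z0 elo eI; apply/matrixP => r x; rewrite mulmx_letterE.
have [->|xlo] := eqVneq x (lo i).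
  rewrite select_mx_refl_lo !mxE rel_level_hi.
  case: (u (lo i) \in I) out z0 => /= [/negPf-> -> //|_ _].
    by rewrite mul0r add0r.
  rewrite mulr0 add0r addn0; case: ifP => // /andP[uhi _]; rewrite eI //.
  by rewrite (inj_eq perm_inj) eq_sym lo_neq_hi.
have [->|xhi] := eqVneq x (hi i).
  rewrite select_mx_refl_hi mxE.
  case: (u (lo i) \in I) out elo => /= [/negPf-> -> //|_ _]; last by rewrite oppr0.
  by rewrite addn0; case: ifP; rewrite ?oppr0.
rewrite select_mx_refl // !mxE; case: ifP => // /andP[ux _].
by rewrite eI // (inj_eq perm_inj).
Qed.

End Restriction.

(** * Crossings and signs *)

Section Crossings.
Local Open Scope ring_scope.
Variables (K : fieldType) (n : nat) (b : seq 'I_n.-1).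
Implicit Types (P : {set {set 'I_n}}) (k : 'I_(size b)) (z : 'rV[K]_(size b)).

Definition crossing k : 'I_n.-1 := tnth (in_tuple b) k.
Definition below k : 'I_n := strand b k (lo (crossing k)).
Definition above k : 'I_n := strand b k (hi (crossing k)).

Lemma strandS_comp k : strand b k.+1 = perm_comp (strand b k) (simple_refl (crossing k)).
Proof. by apply/permP => x; rewrite strandS perm_compE. Qed.

Definition separated P k : bool := pblock P (below k) != pblock P (above k).

Lemma mem_pblockT P x : partition P [set: 'I_n] -> x \in pblock P x.
Proof. by case/and3P=> /eqP covP _ _; rewrite mem_pblock covP inE. Qed.

Lemma pblockT_mem P x : partition P [set: 'I_n] -> pblock P x \in P.
Proof. by case/and3P=> /eqP covP _ _; apply: pblock_mem; rewrite covP inE. Qed.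

Lemma pblockT_eq P I x : partition P [set: 'I_n] -> I \in P -> (pblock P x == I) = (x \in I).
Proof.
move=> partP IP; apply/eqP/idP => [<-|]; first exact: mem_pblockT.
by case/and3P: partP => _ tiP _; apply: def_pblock.
Qed.

Lemma fixed_pointsE P z (c : K) : c != 0 -> c != 1 -> partition P [set: 'I_n] ->
  fixed_points K b P z <->
    braid_variety K b z /\ forall k, separated P k -> z 0 k = 0.
Proof.
move=> c0 c1 partP; split=> -[Xz]; [move=> fixz|move=> z0]; split=> //.
  move=> k.
  rewrite /separated => sep.
  (* This torus element scales the coordinate of the separated crossing [k] by [c], which differs
     from 1, so the coordinate vanishes. *)
  pose t x := if pblock P x == pblock P (below k) then c else 1.
  have tP : subtorus P t.
    split=> [x|I IP x y]; first by rewrite /t; case: ifP => _; rewrite ?oner_neq0.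
    by rewrite -!(pblockT_eq _ partP IP) /t => /eqP-> /eqP->.
  move/rowP/(_ k): (fixz t tP).
  rewrite mxE -/(crossing k) -/(below k) -/(above k) /t eqxx eq_sym (negPf sep) divr1.
  move/eqP; rewrite -subr_eq0 -{2}[z 0 k]mul1r -mulrBl mulf_eq0 subr_eq0 (negPf c1).
  by move/eqP.
move=> t [t0 tP]; apply/rowP => k; rewrite mxE -/(crossing k) -/(below k) -/(above k).
have [/z0->|] := boolP (separated P k); first by rewrite mulr0.
rewrite negbK => /eqP same.
rewrite (tP (pblock P (below k)) _ (below k) (above k)) ?pblockT_mem ?mem_pblockT //.
  by rewrite divff ?mul1r.
by rewrite same mem_pblockT.
Qed.

Section Kept.
Variable I : {set 'I_n}.

Definition sub_crossing k : option 'I_#|I|.-1 :=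
  subbraid_letter I (strand b k) (crossing k).

Lemma sub_crossingE k : isSome (sub_crossing k) = (below k \in I) && (above k \in I).
Proof.
rewrite /sub_crossing; have [/andP[Ilo Ihi]|/negPf out] := boolP (_ && _).
  by have := subbraid_letter_val Ilo Ihi; case: subbraid_letter.
by rewrite /subbraid_letter -/(below k) -/(above k) out.
Qed.

Definition kept : seq 'I_(size b) := [seq k <- enum 'I_(size b) | sub_crossing k].

Lemma size_kept : size kept = size (subbraid I b).
Proof. by rewrite size_pmap size_filter. Qed.

(** The position in [b] of the crossing that gives the [a]-th letter of the subbraid. *)
Definition kept_index (a : 'I_(size (subbraid I b))) : 'I_(size b) :=
  tnth (in_tuple kept) (cast_ord (esym size_kept) a).

Lemma sub_crossing_kept_index a :
  sub_crossing (kept_index a) = Some (tnth (in_tuple (subbraid I b)) a).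
Proof.
have k0 := kept_index a; have j0 := tnth (in_tuple (subbraid I b)) a.
rewrite /kept_index (tnth_nth k0) (tnth_nth j0) /=.
rewrite -(nth_map j0 None Some) // -(nth_map k0 None sub_crossing) ?size_kept //.
by congr nth; rewrite [RHS]pmapS_filter.
Qed.

Lemma kept_index_in a : (below (kept_index a) \in I) && (above (kept_index a) \in I).
Proof. by rewrite -sub_crossingE sub_crossing_kept_index. Qed.

Lemma kept_index_inj : injective kept_index.
Proof.
move=> a a'; have k0 := kept_index a; rewrite /kept_index !(tnth_nth k0) /=.
have uniq_kept : uniq kept by rewrite filter_uniq ?enum_uniq.
by move/eqP; rewrite nth_uniq ?size_kept // => /eqP/val_inj.
Qed.

Lemma kept_index_surj k : below k \in I -> above k \in I -> exists a, kept_index a = k.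
Proof.
move=> Ilo Ihi.
have /tnthP[a ->] : k \in in_tuple kept by rewrite mem_filter sub_crossingE Ilo Ihi mem_enum.
by exists (cast_ord size_kept a); rewrite /kept_index cast_ordK.
Qed.

Lemma prod_kept m (F : 'I_(size b) -> 'M[K]_m) :
  \prod_(k < size b | sub_crossing k) F k =
    \prod_(a < size (subbraid I b)) F (kept_index a).
Proof.
rewrite -big_filter index_enumE -/kept big_tnth.
rewrite /kept_index; case: _ / size_kept.
by apply: eq_bigr => a _; rewrite cast_ord_id.
Qed.

End Kept.

(** The strand [x] picks up a factor [-1] from the block [0 -1; 1 0] of each
    separated crossing that it enters from below. *)
Fixpoint strand_sign P (k : nat) (x : 'I_n) : K :=
  if k is k'.+1 then
    if insub k' is Some l then
      if separated P l && (x == below l) then - strand_sign P k' x else strand_sign P k' x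
    else strand_sign P k' x
  else 1.

Lemma strand_signS P k x :
  strand_sign P k.+1 x =
    if separated P k && (x == below k) then - strand_sign P k x else strand_sign P k x.
Proof. by rewrite /= valK. Qed.

Lemma strand_sign_neq0 P (k : nat) x : strand_sign P k x != 0.
Proof.
elim: k => [|k IH] /=; first by rewrite oner_neq0.
by case: insub => // l; case: ifP; rewrite ?oppr_eq0.
Qed.

(** The rescaling factor of [select_mx_letter_in] when the scalars are the accumulated signs. *)
Definition crossing_sign P k : K :=
  strand_sign P k (below k) / strand_sign P k (above k).

Lemma crossing_sign_neq0 P k : crossing_sign P k != 0.
Proof. by apply: mulf_neq0; rewrite ?invr_eq0 strand_sign_neq0. Qed.

Definition sub_row P I z : 'rV[K]_(size (subbraid I b)) :=
  \row_a (crossing_sign P (kept_index a) * z 0 (kept_index a)).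

(** The matrices [E k] slide through the product one factor at a time. *)
Lemma intertwine_prod m N (A : 'I_N -> 'M[K]_n) (C : 'I_N -> 'M[K]_m)
    (E : nat -> 'M[K]_(m, n)) :
  (forall k : 'I_N, E k *m A k = C k *m E k.+1) ->
  E 0%N *m (\prod_(k < N) A k) = (\prod_(k < N) C k) *m E N.
Proof.
elim: N A C => [|N IH] A C step; first by rewrite !big_ord0 mulmx1 mul1mx.
rewrite !big_ord_recr /= mulmxA (IH _ (fun j => C (widen_ord (leqnSn N) j))); last first.
  by move=> j; apply: (step (widen_ord _ j)).
by rewrite -!mulmxA; congr (_ *m _); apply: (step ord_max).
Qed.

Lemma select_mx_braid P I z : partition P [set: 'I_n] -> I \in P ->
  (forall k, separated P k -> z 0 k = 0) ->
  select_mx I 1%g (fun=> 1) *m braid_mx z =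
    braid_mx (sub_row P I z) *m select_mx I (coxeter b) (strand_sign P (size b)).
Proof.
move=> partP IP z0.
(* A crossing that disappears from the subbraid contributes an identity factor, so both products run
   over all crossings of [b]; [prod_kept] discards these factors at the end. *)
pose C k : 'M[K]_#|I| :=
  if sub_crossing I k is Some j then letter_mx j (crossing_sign P k * z 0 k) else 1.
have step k : select_mx I (strand b k) (strand_sign P k) *m letter_mx (crossing k) (z 0 k) =
    C k *m select_mx I (strand b k.+1) (strand_sign P k.+1).
  rewrite strandS_comp /C.
  have [/andP[Ilo Ihi]|out] := boolP ((below k \in I) && (above k \in I)).
    have := subbraid_letter_val Ilo Ihi; rewrite -/(sub_crossing I k).
    case: (sub_crossing I k) => // j [ej].
    rewrite (select_mx_letter_in _ Ilo Ihi ej) ?strand_sign_neq0 //.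
    (* Both strands lie in the block [I], so the crossing is not separated and no sign changes. *)
    congr (_ *m _); apply/matrixP => r x; rewrite !mxE strand_signS /separated.
    move: Ilo Ihi; rewrite -!(pblockT_eq _ partP IP) => /eqP-> /eqP->.
    by rewrite eqxx.
  have := out; rewrite -sub_crossingE; case: (sub_crossing I k) => // _.
  rewrite mul1mx; apply: select_mx_letter_out => //.
  - rewrite -/(below k) -/(above k) -!(pblockT_eq _ partP IP) => neq; apply: z0.
    by apply: contraNneq neq => ->.
  - rewrite -/(below k) => Ilo; rewrite strand_signS eqxx andbT.
    rewrite /separated; case: eqP => // same; case/negP: out; rewrite Ilo.
    by move: Ilo; rewrite -!(pblockT_eq _ partP IP) same.
  - by move=> p _ /negPf neq; rewrite strand_signS /below neq andbF.
pose E (k : nat) := select_mx I (strand b k) (strand_sign P k).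
have := intertwine_prod (E := E) step.
rewrite /E /strand take0 take_size => ->; congr (_ *m _).
rewrite [RHS](eq_bigr (fun a => C (kept_index a))); last first.
  by move=> a _; rewrite /C sub_crossing_kept_index mxE.
rewrite -prod_kept [RHS]big_mkcond; apply: eq_bigr => k _.
by rewrite /C; case: sub_crossing.
Qed.

End Crossings.

(** * Triangularity block by block *)

Section Triangularity.
Local Open Scope ring_scope.
Variables (K : fieldType) (n : nat).

Lemma w0K : involutive (w0 n).
Proof. by move=> x; rewrite !permE rev_ordK. Qed.

(** The matrix of [w0] is its own inverse, and multiplying by it on the left reverses the rows,
    which exchanges the diagonal with the antidiagonal. *)
Lemma braid_varietyE (b : seq 'I_n.-1) (z : 'rV[K]_(size b)) : demazure b = w0 n ->
  braid_variety K b z <-> anti_triangular (braid_mx z).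
Proof.
move=> dem; rewrite /braid_variety /upper_triangular dem.
have -> : permutation_mx K (w0 n) = perm_mx (w0 n).
  apply/matrixP => p q; rewrite !mxE; congr (_%:R).
  by rewrite -[X in (X == _)](w0K p) (inj_eq perm_inj).
have -> : invmx (perm_mx (w0 n)) = perm_mx (w0 n) :> 'M[K]_n.
  have sq : perm_mx (w0 n) *m perm_mx (w0 n) = 1%:M :> 'M[K]_n.
    by rewrite -perm_mxM -perm_mx1; congr perm_mx; apply/permP => x; rewrite permM w0K perm1.
  by have [w0u _] := mulmx1_unit sq; rewrite -[LHS]mulmx1 -sq mulKmx.
rewrite -row_permE; split=> [/is_trig_mxP tri p q lt|tri].
  have := tri q (w0 n p); rewrite !mxE w0K; apply.
  by rewrite permE /=; lia.
apply/is_trig_mxP => q p lt; rewrite !mxE; apply: tri.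
by rewrite permE /=; have := ltn_ord p; lia.
Qed.

Lemma select_mx_mulE (I : {set 'I_n}) (u : 'S_n) (e : 'I_n -> K) (M : 'M[K]_n) (r : 'I_#|I|) p q :
  u p \in I -> rel_level I u p = r -> (select_mx I u e *m M) r q = e (u p) * M p q.
Proof.
move=> up er; rewrite mxE (bigD1 p) //= !mxE up er eqxx big1 ?addr0 // => y yp.
rewrite mxE; case: ifP => [/andP[uy /eqP ey]|]; rewrite ?mul0r //.
by case/eqP: yp; apply: (rel_level_inj uy up); rewrite ey er.
Qed.

Lemma mul_select_mxE (I : {set 'I_n}) (u : 'S_n) (e : 'I_n -> K) (M : 'M[K]_#|I|) r (s : 'I_#|I|) q :
  u q \in I -> rel_level I u q = s -> (M *m select_mx I u e) r q = M r s * e (u q).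
Proof.
move=> uq es; rewrite mxE (bigD1 s) //= !mxE uq es eqxx big1 ?addr0 // => y ys.
by rewrite mxE es eq_sym val_eqE (negPf ys) andbF mulr0.
Qed.

Lemma mul_select_mx_out (I : {set 'I_n}) (u : 'S_n) (e : 'I_n -> K) (M : 'M[K]_#|I|) r q :
  u q \notin I -> (M *m select_mx I u e) r q = 0.
Proof. by move=> /negPf uq; rewrite mxE big1 // => y _; rewrite mxE uq mulr0. Qed.

(** Since [w x] is the image of [w0 n x] under the composite of [w] and [w0 n], stability says that
    the strands of [I] end at the levels [w0 (I)]. *)
Lemma stable_mem (w : 'S_n) (I : {set 'I_n}) x :
  perm_comp w (w0 n) @: I = I -> (w x \in I) = (w0 n x \in I).
Proof.
move=> stI; rewrite -[x in LHS]w0K -perm_compE -{1}stI mem_imset //.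
exact: perm_inj.
Qed.

(** As [w0] reverses levels, the levels below [q] where strands of [I] end correspond to the
    elements of [I] above [w0 n q]. Splitting [I] at [w0 n q] gives the count, which matches the
    antidiagonal of the minor with that of the full matrix. *)
Lemma rel_level_stable (w : 'S_n) (I : {set 'I_n}) q :
  perm_comp w (w0 n) @: I = I -> w q \in I ->
  (rel_level I w q + (rel_level I 1 (w0 n q)).+1)%N = #|I|.
Proof.
move=> stI Iq; have Iq0 : w0 n q \in I by rewrite -(stable_mem q stI).
pose D := [set x in I | (x <= w0 n q)%N].
rewrite -(cardsID D I) addnC; congr (_ + _)%N.
  rewrite (cardsD1 (w0 n q)) !inE Iq0 leqnn add1n; congr _.+1.
  apply: eq_card => x; rewrite !inE perm1 ltn_neqAle val_eqE.
  by case: (x \in I); rewrite ?andbF ?andbT.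
rewrite /rel_level -(card_preimset (I :\: D) (@perm_inj _ (w0 n))).
apply: eq_card => x; rewrite !inE (stable_mem x stI).
case: (w0 n x \in I); rewrite ?andbF //= !permE /=.
by have := ltn_ord x; have := ltn_ord q; lia.
Qed.

Lemma anti_triangular_sub_row (b : seq 'I_n.-1) (z : 'rV[K]_(size b)) P :
  stable_partition (perm_comp (coxeter b) (w0 n)) P ->
  (forall k, separated P k -> z 0 k = 0) ->
  anti_triangular (braid_mx z) <->
    forall I, I \in P -> anti_triangular (braid_mx (sub_row P I z)).
Proof.
move=> [partP stP] z0; split=> [tri I IP r s lt|tri p q lt].
  (* The entry [(r, s)] of the minor is, up to sign, the entry [(p, q)] of the full matrix;
     [rel_level_stable] and monotonicity of relative levels show that [(p, q)] is also above the
     antidiagonal. *)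
  have [p Ip ep] := rel_level_surj 1 r; have [q Iq eq] := rel_level_surj (coxeter b) s.
  have := congr1 (fun M : 'M[K]_(#|I|, n) => M r q) (select_mx_braid partP IP z0).
  rewrite (select_mx_mulE _ _ _ Ip ep) (mul_select_mxE _ _ _ Iq eq) mul1r.
  have lev := rel_level_stable (stP I IP) Iq.
  rewrite tri => [/esym/eqP|].
    by rewrite mulf_eq0 (negPf (strand_sign_neq0 _ _ _ _ _)) orbF => /eqP.
  case: (ltnP p (w0 n q)) => [|le]; first by rewrite permE /=; lia.
  have : (rel_level I 1 (w0 n q) <= rel_level I 1 p)%N.
    by apply: subset_leq_card; apply/subsetP => x; rewrite !inE => /andP[/leq_trans->].
  move: lt; rewrite -ep -eq; lia.
pose I := pblock P p; have IP : I \in P := pblockT_mem p partP.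
have Ip : (1%g : 'S_n) p \in I by rewrite perm1; apply: mem_pblockT.
pose r := Ordinal (rel_level_bound Ip).
have := congr1 (fun M : 'M[K]_(#|I|, n) => M r q) (select_mx_braid partP IP z0).
rewrite (select_mx_mulE (r := r) _ _ _ Ip) // mul1r.
(* An entry whose column is the end of a strand of another block is zero; any other is an entry of
   the minor of [I]. *)
have [Iq|Iq] := boolP (coxeter b q \in I); last by rewrite mul_select_mx_out.
pose s := Ordinal (rel_level_bound Iq).
rewrite (mul_select_mxE (s := s) _ _ _ Iq) // => ->.
rewrite tri ?mul0r //=.
have lev := rel_level_stable (stP I IP) Iq.
have : (rel_level I 1 p < rel_level I 1 (w0 n q))%N.
  by apply: rel_level_lt => //; rewrite permE /=; lia.
by rewrite -[#|I|]lev addnS /= addnC ltn_add2l.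
Qed.

End Triangularity.

(** * Fixed points *)

Section FixedPoints.
Local Open Scope ring_scope.
Variables (K : fieldType) (c : K) (n : nat) (b : seq 'I_n.-1).
Hypotheses (c0 : c != 0) (c1 : c != 1) (demazure_b : demazure b = w0 n).
Variable P : {set {set 'I_n}}.
Hypothesis stP : stable_partition (perm_comp (coxeter b) (w0 n)) P.

Lemma fixed_points_sub_row z :
  fixed_points K b P z <->
    (forall k, separated P k -> z 0 k = 0) /\
    forall I, I \in P -> anti_triangular (braid_mx (sub_row P I z)).
Proof.
have [partP _] := stP.
rewrite (fixed_pointsE _ c0 c1 partP) (braid_varietyE _ demazure_b).
by split=> [[tri z0]|[z0 tri]]; split=> //; apply/(anti_triangular_sub_row stP z0).
Qed.

Let N := (\sum_(j < #|P|) size (subbraid (enum_val j) b))%N.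

(** Each coordinate of the product comes from a crossing of [b]; this is a bijection onto the
    crossings that are not separated. *)
Let crossing_of (l : 'I_N) : 'I_(size b) :=
  kept_index (tagged (tagnat.sig l)).

Let crossing_of_Rank j (a : 'I_(size (subbraid (enum_val j) b))) :
  crossing_of (tagnat.Rank j a) = kept_index a.
Proof. by rewrite /crossing_of /tagnat.Rank tagnat.rankK. Qed.

Let RankP (l : 'I_N) :
  exists j (a : 'I_(size (subbraid (enum_val j) b))), l = tagnat.Rank j a.
Proof. by exists (tagnat.sig1 l), (tagnat.sig2 l); rewrite tagnat.sig2K. Qed.

Let crossing_of_inj : injective crossing_of.
Proof.
have [partP _] := stP.
move=> l l'; have [j [a ->]] := RankP l; have [j' [a' ->]] := RankP l'.
rewrite !crossing_of_Rank => eq.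
(* The lower strand of the common crossing lies in a single block. *)
have ejj' : j = j'.
  apply: enum_val_inj; have /andP[aj _] := kept_index_in a.
  have /andP[aj' _] := kept_index_in a'; move: aj aj'; rewrite eq.
  by rewrite -!(pblockT_eq _ partP (enum_valP _)) => /eqP ej /eqP ej'; rewrite -[LHS]ej.
by case: j' / ejj' a' eq => a' /kept_index_inj->.
Qed.

Let crossing_of_separated l : ~~ separated P (crossing_of l).
Proof.
have [partP _] := stP; have [j [a ->]] := RankP l.
rewrite crossing_of_Rank negbK; have /andP[] := kept_index_in a.
by rewrite -!(pblockT_eq _ partP (enum_valP _)) => /eqP-> /eqP->.
Qed.

Let crossing_of_surj k : ~~ separated P k -> exists l, crossing_of l = k.
Proof.
have [partP _] := stP; rewrite negbK => /eqP same.
have IP := pblockT_mem (below k) partP.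
pose j := enum_rank_in IP (pblock P (below k)).
have ej : enum_val j = pblock P (below k) by rewrite enum_rankK_in.
have [||a ea] := @kept_index_surj _ b (enum_val j) k.
- by rewrite ej mem_pblockT.
- by rewrite ej same mem_pblockT.
by exists (tagnat.Rank j a); rewrite crossing_of_Rank.
Qed.

Let to_product (l : 'I_N) : {mpoly K[size b]} :=
  crossing_sign K P (crossing_of l) *: 'X_(crossing_of l).

(** The default 0 is taken exactly at the separated crossings, where fixed points vanish. *)
Let from_product (k : 'I_(size b)) : {mpoly K[N]} :=
  if [pick l | crossing_of l == k] is Some l then (crossing_sign K P k)^-1 *: 'X_l else 0.

Let to_productE x l :
  poly_eval to_product x 0 l = crossing_sign K P (crossing_of l) * x 0 (crossing_of l).
Proof. by rewrite mxE mevalZ mevalXU. Qed.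

Let from_productE y l :
  poly_eval from_product y 0 (crossing_of l) = (crossing_sign K P (crossing_of l))^-1 * y 0 l.
Proof.
rewrite mxE /from_product; case: pickP => [l' /eqP/crossing_of_inj->|/(_ l)]; last by rewrite eqxx.
by rewrite mevalZ mevalXU.
Qed.

Let from_product_separated y k : separated P k -> poly_eval from_product y 0 k = 0.
Proof.
rewrite mxE /from_product; case: pickP => [l /eqP<-|_ _]; last by rewrite meval0.
by move=> sep; have := crossing_of_separated l; rewrite sep.
Qed.

Let submxrow_to_product x j :
  submxrow (poly_eval to_product x) j = sub_row P (enum_val j) x.
Proof. by apply/rowP => a; rewrite !mxE mevalZ mevalXU crossing_of_Rank. Qed.

(** The maps only rescale by signs, discard zero coordinates or restore them. The hypothesis on
    Demazure products turns anti-triangularity of each minor into membership in its braid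
    variety. *)
Lemma fixed_points_isomorphic :
  (forall I, I \in P -> demazure (subbraid I b) = w0 #|I|) ->
  isomorphic (fixed_points K b P) (product_variety K b P).
Proof.
move=> dem; exists to_product, from_product; split=> [x|y Yy].
  move=> /fixed_points_sub_row[x0 tri]; split.
    move=> j; apply/(braid_varietyE _ (dem _ (enum_valP j))).
    by rewrite submxrow_to_product; apply: tri; apply: enum_valP.
  apply/rowP => k; have [sep|/crossing_of_surj[l <-]] := boolP (separated P k).
    by rewrite from_product_separated ?x0.
  by rewrite from_productE to_productE mulKf ?crossing_sign_neq0.
have yK : poly_eval to_product (poly_eval from_product y) = y.
  by apply/rowP => l; rewrite to_productE from_productE mulVKf ?crossing_sign_neq0.
split=> //; apply/fixed_points_sub_row; split=> [k|I IP]; first exact: from_product_separated.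
rewrite -(enum_rankK_in IP IP) -submxrow_to_product yK.
by apply/(braid_varietyE _ (dem _ (enum_valP _))); apply: Yy.
Qed.

Lemma fixed_points_demazure z :
  fixed_points K b P z -> forall I, I \in P -> demazure (subbraid I b) = w0 #|I|.
Proof. by move=> /fixed_points_sub_row[_ tri] I /tri; apply: anti_triangular_demazure. Qed.

End FixedPoints.

(** * Common refinements and intersections of fixed loci *)

Lemma coarsest_common_refinement_pblock n (w : 'S_n) (P Q S : {set {set 'I_n}}) x y :
  stable_partition w P -> stable_partition w Q -> coarsest_common_refinement w P Q S ->
  (pblock S x == pblock S y) = (pblock P x == pblock P y) && (pblock Q x == pblock Q y).
Proof.
move=> stP stQ [stS refP refQ max].
have sub A B t s : partition A [set: 'I_n] -> partition B [set: 'I_n] -> refines A B ->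
    pblock A t == pblock A s -> pblock B t == pblock B s.
  move=> pA pB ref /eqP same; have [C BC sAC] := ref _ (pblockT_mem t pA).
  have Ct : t \in C by apply: (subsetP sAC); apply: mem_pblockT.
  have Cs : s \in C by apply: (subsetP sAC); rewrite same; apply: mem_pblockT.
  by move: Ct Cs; rewrite -!(pblockT_eq _ pB BC) => /eqP-> /eqP->.
have [pS _] := stS; have [pP _] := stP; have [pQ _] := stQ.
apply/idP/andP => [same|[/eqP sameP /eqP sameQ]].
  by split; [apply: sub refP same|apply: sub refQ same].
(* Maximality of [S] is applied to the partition into nonempty intersections of blocks, where [x]
   and [y] visibly share a block. *)
have [[pM stM] MP MQ _] := coarsest_common_refinement_exists stP stQ.
apply: (sub _ _ _ _ pM pS (max _ (conj pM stM) MP MQ)).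
have xM : pblock P x :&: pblock Q x \in [set A :&: B | A in P, B in Q] :\ set0.
  rewrite !inE imset2_f ?pblockT_mem // andbT; apply/set0Pn; exists x.
  by rewrite inE !mem_pblockT.
have /eqP-> : pblock ([set A :&: B | A in P, B in Q] :\ set0) x == pblock P x :&: pblock Q x.
  by rewrite (pblockT_eq _ pM xM) inE !mem_pblockT.
by rewrite eq_sym (pblockT_eq _ pM xM) inE sameP sameQ !mem_pblockT.
Qed.

Lemma isomorphic_ext (K : fieldType) m p (X X' : 'rV[K]_m -> Prop) (Y : 'rV[K]_p -> Prop) :
  (forall x, X x <-> X' x) -> isomorphic X Y -> isomorphic X' Y.
Proof.
move=> eqX [f [g [fP gP]]]; exists f, g.
by split=> [x /eqX/fP|y /gP[/eqX]].
Qed.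

Theorem corollary6p21 (R : realType) (n : nat) (b : seq 'I_n.-1)
    (demazure_b : demazure b = w0 n) :
  let ww0 := perm_comp (coxeter b) (w0 n) in
  (forall P : {set {set 'I_n}}, stable_partition ww0 P ->
     ((forall I, I \in P -> demazure (subbraid I b) = w0 #|I|) ->
        isomorphic (fixed_points R[i] b P) (product_variety R[i] b P)) /\
     (~ (forall I, I \in P -> demazure (subbraid I b) = w0 #|I|) ->
        forall z, ~ fixed_points R[i] b P z)) /\
  (forall P Q S : {set {set 'I_n}},
     stable_partition ww0 P -> stable_partition ww0 Q ->
     coarsest_common_refinement ww0 P Q S ->
     (forall z, ~ (fixed_points R[i] b P z /\ fixed_points R[i] b Q z)) \/
     isomorphic (fun z => fixed_points R[i] b P z /\ fixed_points R[i] b Q z)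
                (product_variety R[i] b S)).
Proof.
move=> ww0.
(* The scalar 2 serves as the test value [c], different from 0 and 1. *)
have two0 : (2%:R : R[i])%R != 0%R by rewrite Num.Theory.pnatr_eq0.
have two1 : (2%:R : R[i])%R != 1%R by rewrite Num.Theory.pnatr_eq1.
split=> [P stP|P Q S stP stQ refS].
  split; first exact: (fixed_points_isomorphic two0 two1 demazure_b stP).
  by move=> dem z /(fixed_points_demazure two0 two1 demazure_b stP).
have [stS _ _ _] := refS.
(* A crossing is separated by [S] iff it is separated by [P] or by [Q], so the vanishing conditions
   for [P] and [Q] together are those for [S]. *)
have meetE z : fixed_points R[i] b S z <->
    fixed_points R[i] b P z /\ fixed_points R[i] b Q z.
  rewrite !(fixed_pointsE _ two0 two1) ?(stP.1, stQ.1, stS.1) //.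
  rewrite /separated; split=> [[Xz z0]|[[Xz zP] [_ zQ]]].
    by split; split=> // k sep; apply: z0;
      rewrite (coarsest_common_refinement_pblock _ _ stP stQ refS) negb_and sep ?orbT.
  split=> // k; rewrite (coarsest_common_refinement_pblock _ _ stP stQ refS) negb_and.
  by case/orP => [/zP|/zQ].
have [/forall_inP dem|ndem] := boolP [forall I in S, demazure (subbraid I b) == w0 #|I|].
  right; apply: isomorphic_ext meetE _.
  by apply: (fixed_points_isomorphic two0 two1 demazure_b stS) => I /dem/eqP.
left=> z /meetE /(fixed_points_demazure two0 two1 demazure_b stS) dem.
by case/negP: ndem; apply/forall_inP => I /dem/eqP.
Qed.
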